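(* Let $p\geq 2$, let $G$ be a $2p$-regular graph, and let $\vec{G}$ be an orientation of $G$ that admits an out-neighbourhood bijective homomorphism $\psi$ to $\vec{L}(K_{p+2})$. Then $|V(G)|=q(p+1)(p+2)$ for some positive integer $q$, and $\vec{G}$ can be constructed by (i) starting with the disjoint union $q\,\vec{L}(K_{p+2})$ of $q$ copies of $\vec{L}(K_{p+2})$ together with a locally bijective homomorphism $\varphi$ from $q\,\vec{L}(K_{p+2})$ to $\vec{L}(K_{p+2})$, and (ii) repeating, an arbitrary number of times, arc 2-switch operations on pairs of arcs of the form $(u,v)$ and $(x,y)$ with $\varphi(v)=\varphi(y)$.
   Context: $\vec{L}(K_{p+2})$ is the oriented graph whose vertices are the ordered pairs $(i,j)$ of distinct elements of $\mathbb{Z}_{p+2}$, with an arc from $(i,j)$ to $(j,k)$ whenever $k\neq i$. An out-neighbourhood bijective homomorphism from $\vec{G}$ to $\vec{H}$ is a map $\psi\colon V(\vec{G})\to V(\vec{H})$ such that for every $v$ the restriction of $\psi$ to $N^+_{\vec{G}}(v)$ is a bijection onto $N^+_{\vec{H}}(\psi(v))$. A locally bijective homomorphism between oriented graphs maps, for every vertex $v$, the in-neighbours of $v$ bijectively onto the in-neighbours of the image of $v$ and the out-neighbours of $v$ bijectively onto the out-neighbours of the image of $v$. For an oriented graph and four vertices $u,v,x,y$ such that the subgraph induced by $\{u,v,x,y\}$ has exactly the two arcs $(u,v)$ and $(x,y)$, the arc 2-switch operation on $(u,v)$ and $(x,y)$ removes these two arcs and adds the arcs $(u,y)$ and $(x,v)$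 (the vertex set, and hence the map $\varphi$, is unchanged). *)

(* Defs.v *)
(* A (di)graph is a boolean relation on a finType of vertices. *)
From Stdlib Require Export Relation_Operators.
From mathcomp Require Export all_boot zmodp.

Set Implicit Arguments.
Unset Strict Implicit.
Unset Printing Implicit Defensive.

Definition simple_graph (V : finType) (e : rel V) : Prop :=
  symmetric e /\ irreflexive e.

Definition regular (V : finType) (e : rel V) (d : nat) : Prop :=
  forall v, #|[set w | e v w]| = d.

Definition orientation (V : finType) (e a : rel V) : Prop :=
  forall u v, (e u v = a u v || a v u) /\ ~~ (a u v && a v u).

Definition out_nbrs (V : finType) (a : rel V) (v : V) : {set V} :=
  [set w | a v w].

Definition in_nbrs (V : finType) (a : rel V) (v : V) : {set V} :=
  [set u | a u v].

Definition bij_onto (S T : finType) (f : S -> T) (A : {set S}) (B : {set T}) :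
    Prop :=
  {in A &, injective f} /\ f @: A = B.

(* Preservation of arcs is implied: f maps out_nbrs a v into out_nbrs b (f v). *)
Definition out_bijective_hom (S T : finType) (a : rel S) (b : rel T)
    (f : S -> T) : Prop :=
  forall v, bij_onto f (out_nbrs a v) (out_nbrs b (f v)).

Definition locally_bijective_hom (S T : finType) (a : rel S) (b : rel T)
    (f : S -> T) : Prop :=
  forall v, bij_onto f (in_nbrs a v) (in_nbrs b (f v)) /\
            bij_onto f (out_nbrs a v) (out_nbrs b (f v)).

Definition isomorphic (S T : finType) (a : rel S) (b : rel T) : Prop :=
  exists2 f : S -> T, bijective f & forall u v, a u v = b (f u) (f v).

(* 'Z_p.+2 has exactly p + 2 elements for every p. *)
Definition LK (p : nat) : finType :=
  {ij : 'Z_p.+2 * 'Z_p.+2 | ij.1 != ij.2}.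

Definition LK_arc (p : nat) : rel (LK p) :=
  fun u v => ((val u).2 == (val v).1) && ((val v).2 != (val u).1).

Definition copies_arc (q : nat) (T : finType) (a : rel T) : rel ('I_q * T) :=
  fun s t => (s.1 == t.1) && a s.2 t.2.

(* (u, v) and (x, y) are the only arcs of the subgraph induced by the four
   (pairwise distinct) vertices. *)
Definition switchable (V : finType) (a : rel V) (u v x y : V) : Prop :=
  uniq [:: u; v; x; y] /\
  {in [:: u; v; x; y] &, forall s t, a s t = ((s, t) \in [:: (u, v); (x, y)])}.

Definition arc_switch (V : finType) (a : rel V) (u v x y : V) : rel V :=
  fun s t => (a s t && ((s, t) \notin [:: (u, v); (x, y)]))
             || ((s, t) \in [:: (u, y); (x, v)]).

(* b is only required to be pointwise equal to the switched relation, which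
   avoids any appeal to functional extensionality. *)
Definition switch_step (V T : finType) (phi : V -> T) (a b : rel V) : Prop :=
  exists u v x y : V,
    [/\ switchable a u v x y, phi v = phi y & b =2 arc_switch a u v x y].

Definition switch_reachable (V T : finType) (phi : V -> T) :
    rel V -> rel V -> Prop :=
  clos_refl_trans (rel V) (switch_step phi).

(* Main.v *)
(* Every vertex of D has out-degree p, hence in-degree p.  Counting the arcs
   into a fibre of psi shows that p times the size of the fibre over t is the
   sum of the sizes of the fibres over the p in-neighbours of t; a maximal
   fibre therefore propagates backwards along arcs, and all fibres have the same
   size q.  So V can be identified with 'I_q * LK p, with psi the second
   projection.

   If two arcs have distinct heads in the same fibre, then their four ends
   automatically induce only these two arcs, because of the structure of LK p.
   The arcs into a fibre are given by a function on the tails all of whose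
   values are taken p times, and two such functions are connected by swaps of
   two values, each of which can be chosen to repair a disagreement. *)
Require Import Defs.
From mathcomp Require Import fingroup perm.

Set Implicit Arguments.
Unset Strict Implicit.
Unset Printing Implicit Defensive.

(** * Unique lifting of out-arcs *)

Lemma out_bijective_homP (S T : finType) (a : rel S) (b : rel T) (f : S -> T) :
  out_bijective_hom a b f <->
  [/\ forall s t, a s t -> b (f s) (f t),
      forall s t t', a s t -> a s t' -> f t = f t' -> t = t' &
      forall s c, b (f s) c -> exists2 t, a s t & f t = c].
Proof.
split=> [hf|[hom inj surj] v].
  split=> [s t ast|s t t' ast ast'|s c bsc]; have [inj im] := hf s.
  - have : f t \in f @: out_nbrs a s by rewrite imset_f // inE.
    by rewrite im inE.
  - by apply: inj; rewrite inE.
  - have : c \in f @: out_nbrs a s by rewrite im inE.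
    by case/imsetP=> t; rewrite inE => ast ->; exists t.
split=> [t t'|]; first by rewrite !inE; apply: inj.
apply/setP=> c; rewrite inE; apply/imsetP/idP => [[t]|/surj[t avt <-]].
  by rewrite inE => /hom avt ->.
by exists t; rewrite ?inE.
Qed.

(** * Arc 2-switches on arcs with heads in one fibre *)

Section Switches.

Variables (S T : finType) (h : rel T) (phi : S -> T).
Hypothesis h_asym : forall s t, h s t -> ~~ h t s.
Hypothesis h_in_stable : forall s s' t, h s t -> h s' t -> ~~ h s s'.

Implicit Types a b : rel S.

(** Injectivity on out-neighbourhoods excludes the arcs [(u, y)] and [(x, v)]. Any other extra arc
    would project to a loop, to the reverse of an arc, or to an arc between two in-neighbours of
    [phi v]; [h] has none of these. *)
Lemma switchable_fibre a u v x y : out_bijective_hom a h phi ->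
  a u v -> a x y -> phi v = phi y -> v != y -> switchable a u v x y.
Proof.
move=> /out_bijective_homP[hom inj _] auv axy eq_vy neq_vy.
have h_irr s : h s s = false.
  by apply/negP=> hs; have /negP := h_asym hs; apply.
have nh s t : ~~ h (phi s) (phi t) -> a s t = false.
  by move=> nst; apply/negP=> /hom; apply/negP.
have huv := hom _ _ auv; have hxy := hom _ _ axy.
have huy : h (phi u) (phi y) by rewrite -eq_vy.
have hxv : h (phi x) (phi v) by rewrite eq_vy.
have a_irr s : a s s = false by apply: nh; rewrite h_irr.
have auy : a u y = false.
  by apply/negP=> /(inj _ _ _ auv)/(_ eq_vy)/eqP; apply/negP.
have axv : a x v = false.
  by apply/negP=> /(inj _ _ _ axy)/(_ (esym eq_vy))/esym/eqP; apply/negP.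
have neq s t : h (phi s) (phi t) -> s != t.
  by apply: contraTneq => ->; rewrite h_irr.
have neq_ux : u != x by apply: contraFneq axv => <-.
have uvxy : uniq [:: u; v; x; y].
  rewrite /= !inE !negb_or neq_ux neq_vy (neq _ _ huv) (neq _ _ huy).
  by rewrite (neq _ _ hxy) eq_sym (neq _ _ hxv).
have avy : a v y = false by apply: nh; rewrite eq_vy h_irr.
have ayv : a y v = false by apply: nh; rewrite eq_vy h_irr.
have aux := nh _ _ (h_in_stable huv hxv).
have axu := nh _ _ (h_in_stable hxv huv).
have avu := nh _ _ (h_asym huv); have avx := nh _ _ (h_asym hxv).
have ayu := nh _ _ (h_asym huy); have ayx := nh _ _ (h_asym hxy).
split=> //; move: uvxy; rewrite /= !inE !negb_or => /and4P[].
move=> /and3P[/negPf uv /negPf ux /negPf uy] /andP[/negPf vx /negPf vy] /negPf xy _.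
move=> s t; rewrite !inE => /or4P[] /eqP-> /or4P[] /eqP->;
  rewrite !xpair_eqE ?eqxx ?uv ?ux ?uy ?vx ?vy ?xy ?(eq_sym x u) ?(eq_sym y u)
    ?(eq_sym v u) ?(eq_sym y x) ?(eq_sym y v) ?(eq_sym x v)
    ?ux ?uy ?uv ?xy ?vy ?vx /= ?a_irr //.
Qed.

Section Step.

Variables (a : rel S) (u v x y : S).
Hypotheses (auv : a u v) (axy : a x y) (auy : a u y = false) (axv : a x v = false).

(** Seen from the tails, a switch applies the transposition of [v] and [y] to heads. When
    [phi v = phi y] this transposition preserves [phi], so unique lifting survives. *)
Lemma arc_switch_heads s t :
  arc_switch a u v x y s t =
  a s (if (s == u) || (s == x) then tperm v y t else t).
Proof.
have neq_ux : u != x by apply: contraFneq axv => <-.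
have neq_vy : v != y by apply: contraFneq auy => <-.
rewrite /arc_switch !inE !xpair_eqE.
have [->|su] /= := eqVneq s u.
  rewrite (negPf neq_ux) /= !orbF.
  case: tpermP => [->|->|/eqP/negPf tv /eqP/negPf ty].
  - by rewrite eqxx (negPf neq_vy) auv auy.
  - by rewrite eqxx auv orbT.
  - by rewrite tv ty andbT orbF.
have [->|sx] /= := eqVneq s x; last by rewrite andbT orbF.
case: tpermP => [->|->|/eqP/negPf tv /eqP/negPf ty].
- by rewrite eqxx orbT axy.
- by rewrite eqxx eq_sym (negPf neq_vy) axv andbF.
- by rewrite tv ty andbT orbF.
Qed.

(** The dual form, seen from the heads: tails are transposed, so in-degrees do not change. *)
Lemma arc_switch_tails s t :
  arc_switch a u v x y s t =
  a (if (t == v) || (t == y) then tperm u x s else s) t.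
Proof.
rewrite arc_switch_heads; case: (tpermP v y t) => [->|->|/eqP/negPf tv /eqP/negPf ty].
- rewrite eqxx /=; case: tpermP => [->|->|/eqP/negPf-> /eqP/negPf->] //;
    by rewrite eqxx ?orbT /= ?auy ?axv ?auv ?axy.
- rewrite eqxx orbT /=; case: tpermP => [->|->|/eqP/negPf-> /eqP/negPf->] //;
    by rewrite eqxx ?orbT /= ?auy ?axv ?auv ?axy.
- by rewrite tv ty; case: ifP.
Qed.

Lemma arc_switch_out : phi v = phi y ->
  out_bijective_hom a h phi -> out_bijective_hom (arc_switch a u v x y) h phi.
Proof.
move=> eq_vy /out_bijective_homP[hom inj surj]; apply/out_bijective_homP.
pose k s t := if (s == u) || (s == x) then tperm v y t else t.
have kK s : involutive (k s) by move=> t; rewrite /k; case: (_ || _); rewrite ?tpermK.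
have phik s t : phi (k s t) = phi t.
  by rewrite /k; case: ifP => // _; case: tpermP => [->|->|].
split=> [s t|s t t'|s c].
- by rewrite arc_switch_heads -/(k s t) => /hom; rewrite phik.
- rewrite !arc_switch_heads -/(k s t) -/(k s t') => at1 at2 eq_t.
  by apply: (inv_inj (kK s)); apply: inj at1 at2 _; rewrite !phik.
- move=> /surj[t ast <-]; exists (k s t); last exact: phik.
  by rewrite arc_switch_heads -/(k s (k s t)) kK.
Qed.

Lemma card_in_nbrs_switch t :
  #|in_nbrs (arc_switch a u v x y) t| = #|in_nbrs a t|.
Proof.
have [tvy|tvy] := boolP ((t == v) || (t == y)).
  rewrite -(card_preimset (in_nbrs a t) (@perm_inj _ (tperm u x))).
  by apply: eq_card => s; rewrite !inE arc_switch_tails tvy.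
by apply: eq_card => s; rewrite !inE arc_switch_tails (negPf tvy).
Qed.

End Step.

(** Induction on the number of arcs of [a] outside [b]: as long as there is one, some switch lowers
    this number. *)
Lemma switch_connected a b :
  out_bijective_hom a h phi -> out_bijective_hom b h phi ->
  (forall t, #|in_nbrs a t| = #|in_nbrs b t|) ->
  exists2 b', switch_reachable phi a b' & b' =2 b.
Proof.
move=> + outb; have /out_bijective_homP[homb injb surjb] := outb.
pose wrong c := [set st : S * S | c st.1 st.2 && ~~ b st.1 st.2].
have [n] := ubnP #|wrong a|; elim: n a => // n IH a le_n outa eq_in.
have /out_bijective_homP[homa inja surja] := outa.
have [wrong0|[[u v]]] := set_0Vmem (wrong a).
  (* Here [a] is contained in [b]. Equality follows because each arc of [h] out of [phi s] has
     exactly one lift at [s] in either relation. *)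
  have sub s t : a s t -> b s t.
    move=> ast; apply: contraT => nbst.
    have : (s, t) \in wrong a by rewrite inE /= ast.
    by rewrite wrong0 inE.
  exists a => [|s t]; first exact: rt_refl.
  apply/idP/idP=> [/sub//|bst].
  have [t' ast' eq_t] := surja _ _ (homb _ _ bst).
  by rewrite -(injb _ _ _ (sub _ _ ast') bst eq_t).
rewrite inE => /andP[/= auv nbuv].
(* [y] is the head that [b] prescribes for [u] in the fibre of [v]. *)
have [y buy eq_yv] := surjb _ _ (homa _ _ auv).
have neq_vy : v != y by apply: contraNneq nbuv => ->.
have auy : a u y = false.
  apply: contraNF neq_vy => auy; apply/eqP.
  exact: inja auv auy (esym eq_yv).
(* The in-neighbourhoods of [y] in [a] and [b] have equal size and [u] lies only in the second, so
   some [x] lies only in the first. *)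
have [x] : exists x, x \in in_nbrs a y :\: in_nbrs b y.
  apply/set0Pn; rewrite setD_eq0; apply: contraFN auy => sub_ab.
  have /eqP eq_ab : in_nbrs a y == in_nbrs b y by rewrite eqEcard sub_ab eq_in leqnn.
  by have : u \in in_nbrs a y by [rewrite eq_ab inE]; rewrite inE.
rewrite !inE => /andP[nbxy axy].
have axv : a x v = false.
  by apply: contraNF neq_vy => axv; apply/eqP; apply: inja axv axy _.
have [] := IH (arc_switch a u v x y).
- rewrite -ltnS; apply: leq_trans le_n; rewrite ltnS.
  have neq_ux : u != x by apply: contraFneq axv => <-.
  (* The arc (x, v) may be wrong after the switch; it is traded for (x, y). *)
  have sub : wrong (arc_switch a u v x y) \subset
             (x, v) |: (wrong a :\ (u, v) :\ (x, y)).
    apply/subsetP=> -[s t]; rewrite !inE /= /arc_switch !inE.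
    case/andP=> /orP[/andP[ast]|/orP[/eqP[-> ->]|->//]]; last by rewrite buy.
    by rewrite negb_or => /andP[-> ->] ->; rewrite ast orbT.
  apply: leq_ltn_trans (subset_leq_card sub) _.
  rewrite cardsU1 [X in _ < X](cardsD1 (u, v)) [X in _ < _ + X](cardsD1 (x, y)).
  have neq_arcs : (x, y) != (u, v) by rewrite xpair_eqE negb_and eq_sym neq_ux.
  rewrite !inE /= auv nbuv axy nbxy neq_arcs /= add1n.
  by rewrite ltnS leq_add2r leq_b1.
- exact: arc_switch_out.
- by move=> t; rewrite card_in_nbrs_switch.
move=> b' reach eq_b; exists b' => //.
apply: rt_trans reach; apply: rt_step; exists u, v, x, y; split=> //.
exact: switchable_fibre.
Qed.

End Switches.

(** * Degrees, backward connectivity and harmonic functions on the target *)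

Lemma exists_notin (T : finType) (s : seq T) : size s < #|T| -> exists x, x \notin s.
Proof.
move=> lt_s; have [x /negP xs|all_s] := pickP (fun x => x \notin s).
  by exists x; apply/negP.
suff : #|T| <= size s by rewrite leqNgt lt_s.
apply: leq_trans (card_size s); apply: subset_leq_card.
by apply/subsetP=> x _; move/negbFE: (all_s x).
Qed.

Section TargetGraph.

Variable p : nat.
Implicit Types s t : LK p.

Lemma LK_arc_asym s t : LK_arc s t -> ~~ LK_arc t s.
Proof. by case/andP=> _ h; rewrite /LK_arc (negPf h). Qed.

(** Both tails end where [t] begins, so an arc from [s] to [s'] would force the two coordinates of
    [s'] to be equal. *)
Lemma LK_arc_in_stable s s' t : LK_arc s t -> LK_arc s' t -> ~~ LK_arc s s'.
Proof.
move=> /andP[/eqP st _] /andP[/eqP s't _]; rewrite /LK_arc st -s't.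
by rewrite eq_sym (negPf (valP s')).
Qed.

Lemma card_LK_out t : #|out_nbrs (@LK_arc p) t| = p.
Proof.
case: t => -[i j] /= neq_ij.
have inj : {in out_nbrs (@LK_arc p) (Sub (i, j) neq_ij) &,
             injective (fun s => (val s).2)}.
  move=> [[a b] ab] [[c d] cd]; rewrite !inE /LK_arc /=.
  move=> /andP[/eqP ja _] /andP[/eqP jc _] bd.
  by apply: val_inj; rewrite /= -ja -jc bd.
rewrite -(card_in_imset inj) (_ : _ @: _ = ~: [set i; j]).
  by rewrite cardsCs setCK cards2 neq_ij card_ord subn2.
apply/setP=> k; rewrite !inE negb_or; apply/imsetP/andP => [[[[a b] ab]]|[ki kj]].
  by rewrite inE /LK_arc /= => /andP[/eqP-> bi] ->; rewrite bi eq_sym.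
have jk : (j, k).1 != (j, k).2 by rewrite /= eq_sym.
by exists (Sub (j, k) jk); rewrite // inE /LK_arc /= eqxx.
Qed.

Lemma card_LK_in t : #|in_nbrs (@LK_arc p) t| = p.
Proof.
case: t => -[j k] /= neq_jk.
have inj : {in in_nbrs (@LK_arc p) (Sub (j, k) neq_jk) &,
             injective (fun s => (val s).1)}.
  move=> [[a b] ab] [[c d] cd]; rewrite !inE /LK_arc /=.
  move=> /andP[/eqP ja _] /andP[/eqP jc _] bd.
  by apply: val_inj; rewrite /= ja jc bd.
rewrite -(card_in_imset inj) (_ : _ @: _ = ~: [set j; k]).
  by rewrite cardsCs setCK cards2 neq_jk card_ord subn2.
apply/setP=> i; rewrite !inE negb_or; apply/imsetP/andP => [[[[a b] ab]]|[ij ik]].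
  by rewrite inE /LK_arc /= => /andP[/eqP<- kb] ->; rewrite ab eq_sym.
by exists (Sub (i, j) ij); rewrite // inE /LK_arc /= eqxx eq_sym.
Qed.

Lemma card_LK : #|LK p| = p.+1 * p.+2.
Proof.
rewrite card_sig.
have diag : #|[pred ij : 'Z_p.+2 * 'Z_p.+2 | ij.1 == ij.2]| = p.+2.
  have inj : injective (fun i : 'Z_p.+2 => (i, i)) by move=> i j [].
  rewrite -[RHS]card_ord -(card_imset predT inj); apply: eq_card => -[i j].
  rewrite inE /=; apply/eqP/imsetP => [->|[k _ [-> ->]] //]; by exists j.
have := cardC [pred ij : 'Z_p.+2 * 'Z_p.+2 | ij.1 == ij.2].
rewrite diag card_prod card_ord => card_eq.
apply: (@addnI p.+2); rewrite -mulSn -[RHS]card_eq; congr (_ + _).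
Qed.

(** Every vertex is reached from [t0] by walking backwards along arcs. Such walks can reverse a
    pair, and hence change either coordinate separately. *)
Lemma LK_in_closed (A : pred (LK p)) t0 : 2 <= p -> A t0 ->
  (forall s t, LK_arc s t -> A t -> A s) -> forall t, A t.
Proof.
move=> hp At0 closed.
pose B (i j : 'Z_p.+2) := exists2 t, A t & val t = (i, j).
have back i j k : B j k -> i != j -> i != k -> B i j.
  case=> t At tE ij ik; exists (Sub (i, j) ij) => //.
  by apply: closed At; rewrite /LK_arc /= tE /= eqxx eq_sym.
have B_neq i j : B i j -> i != j by case=> -[[a b] /= ab] _ [<- <-].
(* The backward walk is [(j, k)], [(i, j)], [(l, i)], [(j, l)], [(k, j)]; it needs four distinct
   elements, which is where [2 <= p] enters. *)
have swap j k : B j k -> B k j.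
  move=> Bjk; have neq_jk := B_neq _ _ Bjk.
  have [|i] := exists_notin (s := [:: j; k]); first by rewrite card_ord !ltnS ltnW.
  have [|l] := exists_notin (s := [:: j; k; i]); first by rewrite card_ord !ltnS.
  rewrite !inE !negb_or => /and3P[lj lk li] /andP[ij ik].
  have Bij := back _ _ _ Bjk ij ik.
  have Bli := back _ _ _ Bij li lj.
  have Bjl : B j l by apply: back Bli _ _; rewrite eq_sym.
  by apply: back Bjl _ _; rewrite eq_sym.
have repl1 i j k : B j k -> i != k -> B i k.
  move=> Bjk ik; have [->//|ij] := eqVneq i j.
  exact: back (swap _ _ Bjk) ik ij.
have repl2 i j k : B j k -> j != i -> B j i.
  by move=> Bjk ji; apply: (swap); apply: repl1 (swap _ _ Bjk) _; rewrite eq_sym.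
have all_B i j : i != j -> B i j.
  move=> ij; case t0E: (val t0) => [a b].
  have Bab : B a b by exists t0.
  have [eq_ib|ib] := eqVneq i b.
    by subst b; apply: repl2 (swap _ _ Bab) ij.
  exact: repl2 (repl1 _ _ _ Bab ib) ij.
move=> t; have [s As st] : B (val t).1 (val t).2 by apply: all_B; case: t.
by rewrite -(val_inj (etrans st (esym (surjective_pairing _)))).
Qed.

(** Maximum principle: [n t] is the mean of [n] over the [p] in-neighbours of [t], so all
    in-neighbours of a maximal vertex are maximal. *)
Lemma LK_harmonic_constant (n : LK p -> nat) : 2 <= p ->
  (forall t, p * n t = \sum_(s in in_nbrs (@LK_arc p) t) n s) ->
  forall s t, n s = n t.
Proof.
move=> hp harm s0.
pose m := [arg max_(t > s0) n t].
have max_m t : n t <= n m by rewrite /m; case: arg_maxnP => // i _; apply.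
suff all_m t : n t == n m by move=> t; rewrite (eqP (all_m s0)) (eqP (all_m t)).
move: t; apply: (@LK_in_closed (fun t => n t == n m) m) => // s t st /eqP nt.
have s_in : s \in in_nbrs (@LK_arc p) t by rewrite inE.
rewrite eqn_leq max_m /= leqNgt; apply/negP=> lt_s.
suff : \sum_(s in in_nbrs (@LK_arc p) t) n s < p * n t by rewrite harm ltnn.
have -> : p * n t = \sum_(s' in in_nbrs (@LK_arc p) t) n t.
  by rewrite sum_nat_const card_LK_in.
rewrite (bigD1 s) //= [X in _ < X](bigD1 s) //=.
by rewrite nt -addSn leq_add // leq_sum.
Qed.

End TargetGraph.

(** * Fibres and arc counts *)

Lemma fibre_trivialisation (V T : finType) (psi : V -> T) (q : nat) :
  (forall t, #|[set v | psi v == t]| = q) ->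
  #|V| = q * #|T| /\
  exists2 f : V -> 'I_q * T, bijective f & forall v, (f v).2 = psi v.
Proof.
move=> card_fibre.
have cardV : #|V| = q * #|T|.
  rewrite -sum1_card (partition_big psi predT) //= (eq_bigr (fun=> q)) => [|t _].
    by rewrite sum_nat_const mulnC.
  by rewrite -(card_fibre t) -sum1_card; apply: eq_bigl => v; rewrite inE.
split=> //.
have rank_lt v : index v (enum [set w | psi w == psi v]) < q.
  by rewrite -(card_fibre (psi v)) cardE index_mem mem_enum inE.
(* A vertex is labelled by its rank in the enumeration of its own fibre. *)
exists (fun v => (Ordinal (rank_lt v), psi v)) => //.
apply: inj_card_bij; last by rewrite card_prod card_ord cardV.
move=> v w [eq_rank eq_psi]; rewrite eq_psi in eq_rank.
by apply: (index_inj v _ _ eq_rank); rewrite mem_enum inE ?eq_psi.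
Qed.

Lemma in_degree (V : finType) (G D : rel V) (p : nat) :
  regular G (2 * p) -> orientation G D ->
  (forall v, #|out_nbrs D v| = p) -> forall v, #|in_nbrs D v| = p.
Proof.
move=> hreg hD out v; apply: (@addnI p); rewrite addnn -mul2n -(hreg v) -{1}(out v).
have disj : out_nbrs D v :&: in_nbrs D v = set0.
  by apply/setP=> w; rewrite !inE; have [_ /negPf] := hD v w.
rewrite -cardsUI disj cards0 addn0.
by apply: eq_card => w; rewrite !inE; have [-> _] := hD v w.
Qed.

(** Double counting of the arcs into the fibre over [t]: a vertex [u] sends exactly one arc there if
    [h (psi u) t] holds, and none otherwise. *)
Lemma out_hom_fibre_count (V T : finType) (D : rel V) (h : rel T)
    (psi : V -> T) t :
  out_bijective_hom D h psi ->
  \sum_(v | psi v == t) #|in_nbrs D v| =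
  \sum_(s in in_nbrs h t) #|[set v | psi v == s]|.
Proof.
move=> /out_bijective_homP[hom inj surj].
transitivity (\sum_u \sum_(v | psi v == t) (D u v : nat)).
  rewrite exchange_big; apply: eq_bigr => v _.
  by rewrite -sum1_card big_mkcond /=; apply: eq_bigr => u _; rewrite inE; case: (D u v).
transitivity (\sum_(u | h (psi u) t) 1).
  rewrite [RHS]big_mkcond; apply: eq_bigr => u _ /=.
  case: ifPn => [/surj[w Duw <-]|nh].
    rewrite (bigD1 w) //= Duw big1 // => v /andP[/eqP eq_vw neq_vw].
    by case Duv: (D u v) => //; rewrite (inj _ _ _ Duv Duw eq_vw) eqxx in neq_vw.
  by apply: big1 => v /eqP eq_v; case Duv: (D u v) => //; rewrite -eq_v hom in nh.
rewrite (partition_big psi (mem (in_nbrs h t))) /=; last by move=> u; rewrite inE.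
apply: eq_bigr => s; rewrite inE => hst; rewrite -sum1_card.
by apply: eq_bigl => u; rewrite inE andbC; case: eqP => //= ->.
Qed.

(** * Disjoint copies and the construction of [D] *)

Lemma copies_locally_bijective (q : nat) (T : finType) (a : rel T) :
  locally_bijective_hom (copies_arc (q := q) a) a snd.
Proof.
move=> [k t]; split; split.
- by move=> [i s] [j s']; rewrite !inE => /andP[/= /eqP-> _] /andP[/= /eqP-> _] /= ->.
- apply/setP=> s; rewrite inE; apply/imsetP/idP => [[[i s']]|st].
    by rewrite inE => /andP[_ /= ?] ->.
  by exists (k, s); rewrite // inE /copies_arc eqxx.
- by move=> [i s] [j s']; rewrite !inE => /andP[/= /eqP<- _] /andP[/= /eqP<- _] /= ->.
- apply/setP=> s; rewrite inE; apply/imsetP/idP => [[[i s']]|st].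
    by rewrite inE => /andP[_ /= ?] ->.
  by exists (k, s); rewrite // inE /copies_arc eqxx.
Qed.

Theorem theorem8 (p : nat) (hp : 2 <= p)
  (V : finType) (hV : 0 < #|V|)
  (G : rel V) (hG : simple_graph G) (hreg : regular G (2 * p))
  (D : rel V) (hD : orientation G D)
  (psi : V -> LK p) (hpsi : out_bijective_hom D (@LK_arc p) psi) :
  exists q : nat,
    [/\ 0 < q,
        #|V| = q * (p + 1) * (p + 2) &
        exists phi : 'I_q * LK p -> LK p,
          locally_bijective_hom (copies_arc (q := q) (@LK_arc p)) (@LK_arc p) phi /\
          exists2 D' : rel ('I_q * LK p)%type,
            switch_reachable phi (copies_arc (q := q) (@LK_arc p)) D' &
            isomorphic D D'].
Proof.
have Din : forall v, #|in_nbrs D v| = p.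
  apply: in_degree hreg hD _ => v; have [inj im] := hpsi v.
  by rewrite -(card_in_imset inj) im card_LK_out.
pose n t := #|[set v | psi v == t]|.
(* Since all in-degrees are [p], the fibre over [t] receives [p * n t] arcs, which makes [n]
   harmonic. *)
have n_const : forall s t, n s = n t.
  apply: LK_harmonic_constant => // t; rewrite -(out_hom_fibre_count t hpsi).
  rewrite (eq_bigr (fun=> p)) // sum_nat_const mulnC; congr (_ * _).
  by apply: eq_card => v; rewrite !inE.
have /card_gt0P[v0 _] := hV.
have [cardV [f f_bij f_snd]] := fibre_trivialisation (fun t => n_const t (psi v0)).
set q := n (psi v0) in f f_bij f_snd cardV.
exists q; split; last 1 first.
- have loc := @copies_locally_bijective q _ (@LK_arc p).
  exists snd; split=> //.
  have [g fK gK] := f_bij.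
  have g_psi s : psi (g s) = s.2 by rewrite -f_snd gK.
  (* [E] is [D] transported along [f], so that it shares its vertex set and its projection [snd]
     with the disjoint copies. *)
  pose E : rel ('I_q * LK p) := fun s t => D (g s) (g t).
  have outE : out_bijective_hom E (@LK_arc p) snd.
    have /out_bijective_homP[hom inj surj] := hpsi.
    apply/out_bijective_homP; split=> [s t|s t t' st st' eq_t|s c].
    - by rewrite -!g_psi; apply: hom.
    - by apply: (can_inj gK); apply: inj st st' _; rewrite !g_psi.
    - by rewrite -g_psi => /surj[v sv <-]; exists (f v); rewrite /E ?fK.
  have inE t : #|in_nbrs E t| = p.
    have -> : in_nbrs E t = g @^-1: in_nbrs D (g t).
      by apply/setP=> s; rewrite !inE.
    by rewrite on_card_preimset ?Din //; exists f => s _.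
  have in_copies t : #|in_nbrs (copies_arc (q := q) (@LK_arc p)) t| = p.
    by have [[inj im] _] := loc t; rewrite -(card_in_imset inj) im card_LK_in.
  (* Both relations lift out-arcs uniquely over [snd] and have all in-degrees equal to [p], so
     switches lead from the copies to [E]. *)
  have [|t|D' reach eqD] := switch_connected (@LK_arc_asym p) (@LK_arc_in_stable p)
    (a := copies_arc (q := q) (@LK_arc p)) _ outE.
  + by move=> s; have [] := loc s.
  + by rewrite inE in_copies.
  exists D' => //; exists f => // u v.
  by rewrite eqD /E !fK.
- by apply/card_gt0P; exists v0; rewrite inE.
- by rewrite cardV card_LK !addn1 !addn2 mulnA.
Qed.
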